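(* Let $H$ be a graph and $k$ a positive integer. (i) $\overline{\operatorname{box}}(H)\le k$ if and only if there exist positive integers $d_1,\ldots,d_k$ such that $H$ is the intersection graph of sets of the form $B_1\times\cdots\times B_k$, where for each $i\in\{1,\ldots,k\}$ the set $B_i$ is a $1$-local $d_i$-dimensional box. (ii) $\operatorname{box}_\ell(H)\le k$ if and only if there exists some $d$ such that $H$ is the intersection graph of $k$-local $d$-dimensional boxes.
   Context: All graphs are finite and simple; $H^c$ denotes the complement of $H$. An interval graph is an intersection graph of intervals on the real line; a co-interval graph is the complement of an interval graph. $\mathcal{C}$ is the class of all co-interval graphs and $\overline{\mathcal{C}}$ the class of all vertex-disjoint unions of co-interval graphs. A graph homomorphism $\varphi: G\to H$ is a map $V(G)\to V(H)$ with $uv\in E(G)\Rightarrow\varphi(u)\varphi(v)\in E(H)$. For a graph class $\mathcal{G}$, a graph $H$ and a positive integer $t$, a $t$-global $\mathcal{G}$-cover of $H$ is an edge-surjective homomorphism $\varphi: G_1\sqcup\cdots\sqcup G_t\to H$ with each $G_i\in\mathcal{G}$; it is injective if its restriction to each $G_i$ is injective, and $s$-local if $|\varphi^{-1}(v)|\le s$ for all $v\in V(H)$. $c_g^{\mathcal{G}}(H)$ is the minimum $t$ such that a $t$-global injective $\mathcal{G}$-cover of $H$ exists; $c_\ell^{\mathcal{G}}(H)$ is the minimum $s$ such that an $s$-local injective $\mathcal{G}$-cover of $H$ exists (any $t$). Define $\overline{\operatorname{box}}(H):=c_g^{\overline{\mathcal{C}}}(H^c)$ and $\operatorname{box}_\ell(H):=c_\ell^{\mathcal{C}}(H^c)$.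 A $d$-dimensional box is a Cartesian product $I_1\times\cdots\times I_d$ of $d$ intervals of $\mathbb{R}$; for $k\le d$ it is $k$-local if $I_i\ne\mathbb{R}$ for at most $k$ indices $i$. $H$ is the intersection graph of sets $S(v)$, $v\in V(H)$, if $uv\in E(H)\iff S(u)\cap S(v)\neq\emptyset$ for distinct $u,v$. *)

(* Defs.v *)
From HB Require Import structures.
From mathcomp Require Import all_boot all_order all_algebra.
From mathcomp Require Import all_classical all_reals normedtype.

Set Implicit Arguments.
Unset Strict Implicit.
Unset Printing Implicit Defensive.

Local Open Scope classical_set_scope.

Record sgraph := SGraph {
  vert :> finType;
  adj : rel vert;
  adj_sym : symmetric adj;
  adj_irr : irreflexive adj }.

Section Complement.
Variable H : sgraph.

Definition compl_rel : rel H := fun u v => (u != v) && ~~ adj u v.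

Lemma compl_sym : symmetric compl_rel.
Proof. by move=> u v; rewrite /compl_rel eq_sym adj_sym. Qed.

Lemma compl_irr : irreflexive compl_rel.
Proof. by move=> u; rewrite /compl_rel eqxx. Qed.

Definition compl : sgraph := SGraph compl_sym compl_irr.

End Complement.

Section DisjointUnion.
Variables (n : nat) (F : 'I_n -> sgraph).

Definition dunion_rel : rel {i : 'I_n & F i} :=
  fun x y => (tag x == tag y) && adj (tagged x) (tagged_as x y).

Lemma dunion_sym : symmetric dunion_rel.
Proof.
move=> [i x] [j y]; rewrite /dunion_rel /= eq_sym.
case: eqP => // eji; move: y; rewrite eji => y.
by rewrite !tagged_asE adj_sym.
Qed.

Lemma dunion_irr : irreflexive dunion_rel.
Proof. by move=> [i x]; rewrite /dunion_rel tagged_asE adj_irr andbF. Qed.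

Definition dunion : sgraph := SGraph dunion_sym dunion_irr.

End DisjointUnion.

Definition graph_iso (G H : sgraph) : Prop :=
  exists2 f : G -> H, bijective f & forall u v, adj (f u) (f v) = adj u v.

Definition graph_hom (G H : sgraph) (f : G -> H) : Prop :=
  forall u v, adj u v -> adj (f u) (f v).

Definition edge_surjective (G H : sgraph) (f : G -> H) : Prop :=
  forall u v, adj u v -> exists x y, [/\ adj x y, f x = u & f y = v].

Definition intersection_graph (T : Type) (H : sgraph) (S : H -> set T) : Prop :=
  forall u v : H, u <> v -> (adj u v <-> S u `&` S v !=set0).

(* Intervals are nonempty; they may be open, closed, half-open, bounded or
   not, and the whole line is one. The nonemptiness matters: an empty factor
   in a single dimension would isolate a vertex at locality cost 1. *)
Definition real_interval (R : realType) (I : set R) : Prop :=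
  I !=set0 /\ is_interval I.

Definition interval_graph (R : realType) (G : sgraph) : Prop :=
  exists I : G -> set R,
    (forall v, real_interval (I v)) /\ intersection_graph I.

Definition cointerval_graph (R : realType) (G : sgraph) : Prop :=
  interval_graph R (compl G).

Definition cointerval_union (R : realType) (G : sgraph) : Prop :=
  exists n (F : 'I_n -> sgraph),
    (forall i, cointerval_graph R (F i)) /\ graph_iso G (dunion F).

Section Covers.
Variables (Gc : sgraph -> Prop) (H : sgraph).

Definition global_cover (t : nat) (F : 'I_t -> sgraph) (f : dunion F -> H) :=
  [/\ (0 < t)%N, forall i, Gc (F i), graph_hom f & edge_surjective f].

Definition injective_cover (t : nat) (F : 'I_t -> sgraph) (f : dunion F -> H) :=
  forall i, injective (fun x : F i => f (Tagged (fun j => vert (F j)) x)).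

Definition local_cover (s t : nat) (F : 'I_t -> sgraph) (f : dunion F -> H) :=
  forall v : H, (#|[pred x | f x == v]| <= s)%N.

End Covers.

(* The minimum of a set of naturals, [None] standing for infinity (empty set). *)
Definition min_nat (P : nat -> Prop) : option nat :=
  if pselect (exists n, `[< P n >]) is left h then Some (ex_minn h) else None.

Definition min_le (m : option nat) (k : nat) : Prop :=
  if m is Some n then (n <= k)%N else False.

Definition cover_global (Gc : sgraph -> Prop) (H : sgraph) : option nat :=
  min_nat (fun t => exists (F : 'I_t -> sgraph) (f : dunion F -> H),
    global_cover Gc f /\ injective_cover f).

Definition cover_local (Gc : sgraph -> Prop) (H : sgraph) : option nat :=
  min_nat (fun s => exists t (F : 'I_t -> sgraph) (f : dunion F -> H),
    [/\ global_cover Gc f, injective_cover f & local_cover s f]).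

Definition box_union (R : realType) (H : sgraph) : option nat :=
  cover_global (cointerval_union R) (compl H).

Definition box_local (R : realType) (H : sgraph) : option nat :=
  cover_local (cointerval_graph R) (compl H).

Definition local_box (R : realType) (k d : nat) (B : set 'rV[R]_d) : Prop :=
  (k <= d)%N /\
  exists I : 'I_d -> set R,
    [/\ forall i, real_interval (I i),
        (#|[pred i | `[< I i <> setT >]]| <= k)%N
      & B = [set x : 'rV[R]_d | forall i, I i (x ord0 i)]].

Definition box_product (R : realType) (k : nat) (d : 'I_k -> nat)
    (B : forall i, set 'rV[R]_(d i)) : set (forall i, 'rV[R]_(d i)) :=
  [set x | forall i, B i (x i)].

(* Main.v *)
Require Import Defs.
From HB Require Import structures.
From mathcomp Require Import all_boot all_order all_algebra.
From mathcomp Require Import all_classical all_reals.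

(** A box family with [d] factors is the same as [d] interval graphs on [V(H)]
    whose intersection is [H], i.e. [d] co-interval graphs covering [H^c].
    A vertex whose [i]-th factor is the whole line is isolated in the [i]-th
    co-interval graph and can be deleted from it; conversely a vertex missing
    from the [i]-th co-interval graph receives the whole line.  Hence the number
    of preimages of [v] under the cover equals the number of factors of the box
    of [v] other than the line.  Grouping the factors in [k] blocks, a block is
    a disjoint union of co-interval graphs, and injectivity of the cover on the
    block says precisely that the corresponding box is [1]-local. *)

Set Implicit Arguments.
Unset Strict Implicit.
Unset Printing Implicit Defensive.

Local Open Scope classical_set_scope.

(** * Bounds on minima and edges of disjoint unions *)

Lemma min_leP (P : nat -> Prop) (k : nat) :
  min_le (min_nat P) k <-> exists2 n, (n <= k)%N & P n.
Proof.
rewrite /min_nat; case: pselect => [h|nh] /=; last first.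
  by split=> // -[n _ Pn]; apply: nh; exists n; apply/asboolP.
case: ex_minnP => m /asboolP Pm minm; split; first by move=> mk; exists m.
by move=> [n nk Pn]; apply: leq_trans nk; apply/minm/asboolP.
Qed.

Section DisjointUnionTheory.
Variables (n : nat) (F : 'I_n -> sgraph).

Definition dinj (i : 'I_n) (a : F i) : dunion F := Tagged (fun j => vert (F j)) a.

Lemma adj_dinj i (a b : F i) : adj (dinj a) (dinj b) = adj a b.
Proof. by rewrite /= /dunion_rel /= eqxx tagged_asE. Qed.

Lemma dunion_adjP (x y : dunion F) : adj x y ->
  exists i (a b : F i), [/\ x = dinj a, y = dinj b & adj a b].
Proof.
case: x y => [i a] [j b]; rewrite /= /dunion_rel /= => /andP[/eqP eij].
by subst j; rewrite tagged_asE => ab; exists i, a, b.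
Qed.

End DisjointUnionTheory.

(** * Intersections of boxes, and padding by whole-line factors *)

Section Intervals.
Variable R : realType.
Implicit Types A B : set R.

Definition meets A B := A `&` B !=set0.

Lemma real_interval_setT : real_interval (@setT R).
Proof. by split; [exists 0%R|]. Qed.

Lemma meetsTl A : real_interval A -> meets setT A.
Proof. by rewrite /meets setTI => -[]. Qed.

Lemma meetsTr A : real_interval A -> meets A setT.
Proof. by rewrite /meets setIT => -[]. Qed.

Definition box d (I : 'I_d -> set R) : set 'rV[R]_d :=
  [set x | forall i, I i (x ord0 i)].

Definition nfactors d (I : 'I_d -> set R) : nat :=
  #|[pred i | `[< I i <> setT >]]|.

Lemma box_meets d (I J : 'I_d -> set R) :
  box I `&` box J !=set0 <-> forall i, meets (I i) (J i).
Proof.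
split=> [[x [Ix Jx]] i|/choice[x xP]]; first by exists (x ord0 i).
by exists (\row_i x i)%R; split=> i; rewrite mxE; case: (xP i).
Qed.

Lemma box_product_meets k (d : 'I_k -> nat) (B C : forall i, set 'rV[R]_(d i)) :
  box_product B `&` box_product C !=set0 <-> forall i, B i `&` C i !=set0.
Proof.
split=> [[x [Bx Cx]] i|BC]; first by exists (x i).
by exists (fun i => sval (cid (BC i))); split=> i; case: (svalP (cid (BC i))).
Qed.

(** The [m] extra whole-line factors change neither which boxes meet nor the number of nontrivial
    factors. They only raise the dimension, as [local_box m] demands at least [m] factors. *)
Definition pad n m (I : 'I_n -> set R) (i : 'I_(n + m)) : set R :=
  if fintype.split i is inl j then I j else setT.

Lemma pad_lshift n m (I : 'I_n -> set R) i : pad (m := m) I (lshift m i) = I i.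
Proof. by rewrite /pad (unsplitK (inl i)). Qed.

Lemma pad_meets n m (I J : 'I_n -> set R) :
  (forall i, meets (pad (m := m) I i) (pad J i)) <-> forall i, meets (I i) (J i).
Proof.
split=> [IJ i|IJ i]; first by have := IJ (lshift m i); rewrite !pad_lshift.
by rewrite /pad; case: fintype.split => // _; apply/meetsTl/real_interval_setT.
Qed.

(** Every factor other than the line sits at an index in the image of [lshift m], so there are no
    more of them than in [I]. *)
Lemma local_box_pad n m (I : 'I_n -> set R) :
  (forall i, real_interval (I i)) -> (nfactors I <= m)%N ->
  local_box m (box (pad (m := m) I)).
Proof.
move=> Iint Im; split; first exact: leq_addl.
exists (pad I); split=> //.
  by move=> i; rewrite /pad; case: fintype.split => // _; exact: real_interval_setT.
apply: leq_trans Im; apply: leq_trans (leq_image_card (lshift m) _).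
apply/subset_leq_card/fintype.subsetP => i; rewrite inE /pad.
case: (splitP i) => [j ij|j _] ne //.
by apply/fintype.imageP; exists j; [rewrite inE|apply: val_inj].
Qed.

End Intervals.

(** * From a cover to interval families *)

Section CoverToIntervals.
Variables (R : realType) (H : sgraph).

(** One co-interval piece of a cover is turned into intervals on all of [H]. Vertices outside the
    image of [g] receive the line, which meets every interval. An edge of [H] inside the image is a
    non-edge of [G], since [g] maps edges to edges of the complement. *)
Lemma extend_intervals (G : sgraph) (g : G -> compl H) :
  cointerval_graph R G -> injective g -> graph_hom g ->
  exists I : H -> set R,
    [/\ forall v, real_interval (I v),
        forall v, I v <> setT -> exists x, g x = v,
        forall u v, adj u v -> meets (I u) (I v)
      & forall x y, adj x y -> ~ meets (I (g x)) (I (g y))].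
Proof.
move=> [J [Jint JG]] ginj ghom.
(* This is the intersection of the intervals [J x] over the preimages [x] of [v]: the whole line
   when there are none, and [J x] itself when [v = g x], by injectivity. *)
pose I (v : H) := [set r : R | forall x, g x = v -> J x r].
have IE x : I (g x) = J x.
  by apply/seteqP; split=> r; [apply|move=> Jr y /ginj->].
have IT v : (exists x, g x = v) \/ I v = setT.
  case: (pselect (exists x, g x = v)) => [|nv]; [by left|right].
  by apply/seteqP; split=> // r _ x gx; case: nv; exists x.
have Iint v : real_interval (I v).
  by case: (IT v) => [[x <-]|->]; rewrite ?IE//; exact: real_interval_setT.
exists I; split=> //.
- by move=> v Iv; case: (IT v).
- move=> u v uv; case: (IT u) => [[x xu]|->]; last exact: meetsTl.
  case: (IT v) => [[y yv]|->]; last exact: meetsTr.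
  have xy : x <> y by move=> xy; move: uv; rewrite -xu -yv xy adj_irr.
  rewrite -xu -yv !IE; apply/(JG x y xy); apply/andP; split; first exact/eqP.
  by apply/negP => /ghom; rewrite /= /compl_rel xu yv uv andbF.
- move=> x y xy; rewrite !IE => Jxy.
  have ne : x <> y by move=> e; move: xy; rewrite e adj_irr.
  by move/(JG x y ne): Jxy; rewrite /= /compl_rel xy andbF.
Qed.

(** The count holds because [tag] maps the fibre of [v] onto a set of indices that contains all [i]
    with [I v i] other than the line. *)
Lemma cover_intervals n (F : 'I_n -> sgraph) (f : dunion F -> compl H) :
  (forall i, cointerval_graph R (F i)) -> graph_hom f -> injective_cover f ->
  exists I : H -> 'I_n -> set R,
    [/\ forall v i, real_interval (I v i),
        forall v, (nfactors (I v) <= #|[pred x | f x == v]|)%N,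
        forall u v, adj u v -> forall i, meets (I u i) (I v i)
      & forall x y, adj x y -> ~ forall i, meets (I (f x) i) (I (f y) i)].
Proof.
move=> Fint fhom finj.
have Fhom i : graph_hom (fun a : F i => f (dinj a)).
  by move=> a b ab; apply: fhom; rewrite adj_dinj.
have /choice[I IP] i := extend_intervals (Fint i) (@finj i) (Fhom i).
exists (fun v i => I i v); split.
- by move=> v i; case: (IP i).
- move=> v; apply: leq_trans (leq_image_card (@tag _ _) _).
  apply/subset_leq_card/fintype.subsetP => i; rewrite inE => Iv.
  have [_ /(_ v Iv)[a fa] _ _] := IP i.
  by apply/fintype.imageP; exists (dinj a) => //; rewrite inE fa.
- by move=> u v uv i; case: (IP i) => _ _ /(_ u v uv).
- move=> x y /dunion_adjP[i [a [b [-> -> ab]]]] /(_ i).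
  by case: (IP i) => _ _ _ /(_ a b ab).
Qed.

End CoverToIntervals.

(** * From interval families to a cover *)

Section IntervalsToCover.
Variables (R : realType) (H : sgraph).

Section Layer.
Variable I : H -> set R.

(** A vertex carrying the whole line would be isolated in the layer; deleting it saves a preimage in
    the cover. *)
Definition layer_vert : finType := {v : H | `[< I v <> setT >]}.

Definition layer_rel : rel layer_vert :=
  fun u v => (u != v) && ~~ `[< meets (I (val u)) (I (val v)) >].

Lemma layer_sym : symmetric layer_rel.
Proof. by move=> u v; rewrite /layer_rel eq_sym /meets setIC. Qed.

Lemma layer_irr : irreflexive layer_rel.
Proof. by move=> u; rewrite /layer_rel eqxx. Qed.

Definition layer : sgraph := SGraph layer_sym layer_irr.

Lemma layer_cointerval :
  (forall v, real_interval (I v)) -> cointerval_graph R layer.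
Proof.
move=> Iint; exists (fun v : layer => I (val v)); split=> // u v /eqP uv.
rewrite /= /compl_rel /= /layer_rel uv /= negbK.
by split=> /asboolP.
Qed.

End Layer.

Variables (n : nat) (I : H -> 'I_n -> set R).
Hypothesis Iint : forall v i, real_interval (I v i).
Hypothesis Imeets : forall u v, adj u v -> forall i, meets (I u i) (I v i).

Definition layers (i : 'I_n) : sgraph := layer (I^~ i).

Definition layers_map (x : dunion layers) : compl H := val (tagged x).

Lemma layers_hom : graph_hom layers_map.
Proof.
move=> x y /dunion_adjP[i [a [b [-> -> /andP[ab /asboolP nab]]]]].
apply/andP; split; first by apply: contra ab => /eqP e; apply/eqP/val_inj.
by apply/negP => /Imeets /(_ i).
Qed.

Lemma layers_injective : injective_cover layers_map.
Proof. by move=> i; exact: val_inj. Qed.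

(** A preimage of [v] is determined by its layer, so [tag] is injective on the fibre, with values
    among the nontrivial factors of [v]. *)
Lemma layers_map_card v :
  (#|[pred x | layers_map x == v]| <= nfactors (I v))%N.
Proof.
rewrite -(@card_in_image _ _ (@tag _ (fun i => vert (layers i)))).
  apply/subset_leq_card/fintype.subsetP => i /fintype.imageP[[j a]] /eqP <- ->.
  by rewrite inE; exact/asboolP/(valP a).
move=> [i a] [j b] /eqP av /eqP bv /= ij; subst j.
by congr Tagged; apply: val_inj; exact: etrans av (esym bv).
Qed.

(** In a factor where the two intervals are disjoint neither can be the line, so both vertices
    survive in that layer and are adjacent there. *)
Lemma layers_edge u v : u <> v -> ~ (forall i, meets (I u i) (I v i)) ->
  exists x y, [/\ adj x y, layers_map x = u & layers_map y = v].
Proof.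
move=> uv /existsNP[i nuv].
have uP : `[< I u i <> setT >].
  by apply/asboolP => uT; apply: nuv; rewrite uT; exact: meetsTl.
have vP : `[< I v i <> setT >].
  by apply/asboolP => vT; apply: nuv; rewrite vT; exact: meetsTr.
pose a : layers i := Sub u uP; pose b : layers i := Sub v vP.
exists (dinj a), (dinj b); split=> //; rewrite adj_dinj.
by apply/andP; split; [apply/eqP => -[]|apply/asboolP].
Qed.

End IntervalsToCover.

(** * The two equivalences *)

Lemma compl_adjP (H : sgraph) (u v : compl H) :
  adj u v -> u <> v /\ ~ adj (u : H) v.
Proof. by move=> /andP[/eqP ? /negP]. Qed.

(** A single injective block gives 1-local boxes: [g] composed with the isomorphism is injective on
    the whole disjoint union, not just on each component, so all fibres have at most one element. *)
Lemma union_cover_intervals (R : realType) (H G : sgraph) (g : G -> compl H) :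
  cointerval_union R G -> graph_hom g -> injective g ->
  exists n (I : H -> 'I_n -> set R),
    [/\ forall v i, real_interval (I v i),
        forall v, (nfactors (I v) <= 1)%N,
        forall u v, adj u v -> forall i, meets (I u i) (I v i)
      & forall x y, adj x y -> ~ forall i, meets (I (g x) i) (I (g y) i)].
Proof.
move=> [n [F [Fint [h [h' hK h'K] hadj]]]] ghom ginj.
have finj : injective (g \o h') by exact/(inj_comp ginj)/(can_inj h'K).
have fhom : graph_hom (g \o h' : dunion F -> compl H).
  by move=> x y xy; apply: ghom; rewrite -hadj !h'K.
have [|I [Iint In Iadj Inadj]] := cover_intervals Fint fhom.
  by move=> i a b /finj /eqP; rewrite eq_Tagged => /eqP.
exists n, I; split=> //.
- move=> v; apply: leq_trans (In v) _; apply/card_le1_eqP => x y.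
  by rewrite !inE => /eqP xv /eqP yv; apply: finj; rewrite xv yv.
- by move=> x y; rewrite -hadj => /Inadj /=; rewrite !hK.
Qed.

Lemma box_union_leP (R : realType) (H : sgraph) (k : nat) : (0 < k)%N ->
  min_le (box_union R H) k <->
    exists d : 'I_k -> nat,
      (forall i, (0 < d i)%N) /\
      exists S : H -> set (forall i, 'rV[R]_(d i)),
        intersection_graph S /\
        forall v, exists B : forall i, set 'rV[R]_(d i),
          (forall i, local_box 1 (B i)) /\ S v = box_product B.
Proof.
move=> k_gt0; rewrite /box_union min_leP; split.
  move=> [t tk [F [f [[_ Fint fhom fsurj] finj]]]].
  (* The cover has [t <= k] blocks, so an index [i] may have no block. The dimension is packed with
     the intervals, and the separation property is conditional on a proof of [i < t]. *)
  have /choice[D DP] (i : 'I_k) : exists D : {n & H -> 'I_n -> set R},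
    [/\ forall v j, real_interval (projT2 D v j),
        forall v, (nfactors (projT2 D v) <= 1)%N,
        forall u v, adj u v -> forall j, meets (projT2 D u j) (projT2 D v j)
      & forall (it : (i < t)%N) (a b : F (Ordinal it)), adj a b ->
          ~ forall j, meets (projT2 D (f (dinj a)) j) (projT2 D (f (dinj b)) j)].
    have /orP[it|/negP ti] := orbN (i < t)%N; last first.
      (* An index without a block gets no intervals at all; padding turns this into the full
         one-dimensional box. *)
      exists (existT _ 0 (fun _ _ => setT)); split=> //= [_ []//|v|? ? _ []//].
      by rewrite /nfactors (leq_trans (max_card _)) // card_ord.
    have [|n [I [I1 I2 I3 I4]]] :=
      union_cover_intervals (Fint (Ordinal it)) _ (@finj (Ordinal it)).
      by move=> a b ab; apply: fhom; rewrite adj_dinj.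
    exists (existT _ n I); split=> //= it' a b.
    by rewrite (bool_irrelevance it' it) in a b * => /I4.
  pose B v i := box (pad (m := 1) (projT2 (D i) v)).
  (* The extra factor makes every dimension positive. *)
  exists (fun i => projT1 (D i) + 1); split; first by move=> i; rewrite addn1.
  exists (fun v => box_product (B v)); split; last first.
    move=> v; exists (B v); split=> // i.
    by have [? ? _ _] := DP i; exact: local_box_pad.
  move=> u v uv; rewrite box_product_meets; split=> [auv i|Buv].
    by have [_ _ Iadj _] := DP i; apply/box_meets/pad_meets/Iadj.
  (* If [u] and [v] were non-adjacent in [H], the edge [uv] of the complement would lift to some
     block, where one pair of intervals is disjoint. *)
  apply/negPn/negP => nuv.
  have /fsurj[x [y [/dunion_adjP[i [a [b [-> -> ab]]]] fx fy]]] :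
    @adj (compl H) u v by apply/andP; split=> //; exact/eqP.
  have ik : (i < k)%N by apply: leq_trans tk.
  have [_ _ _] := DP (Ordinal ik).
  case: i a b ab fx fy ik => i it a b ab fx fy ik /(_ it a b ab); apply.
  by rewrite fx fy; have /box_meets/pad_meets := Buv (Ordinal ik).
move=> [d [_ [S [SH /choice[B BP]]]]].
have Iex i : exists I : H -> 'I_(d i) -> set R,
  forall v, [/\ forall j, real_interval (I v j), (nfactors (I v) <= 1)%N
              & B v i = box (I v)].
  suff /choice[I IP] v : exists J : 'I_(d i) -> set R,
    [/\ forall j, real_interval (J j), (nfactors J <= 1)%N & B v i = box J].
    by exists I.
  by have [/(_ i)[_]] := BP v.
(* The type of the family depends on [i] through [d i], so this choice is made with [cid]. *)
have [I IP] : exists I : forall i, H -> 'I_(d i) -> set R, forall i v,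
    [/\ forall j, real_interval (I i v j), (nfactors (I i v) <= 1)%N
      & B v i = box (I i v)].
  by exists (fun i => sval (cid (Iex i))) => i; exact: svalP (cid (Iex i)).
have Iadj u v : adj u v -> forall i j, meets (I i u j) (I i v j).
  move=> auv; have uv : u <> v by move=> e; move: auv; rewrite e adj_irr.
  move/(SH u v uv): auv; have [_ ->] := BP u; have [_ ->] := BP v.
  rewrite box_product_meets => Buv i; apply/box_meets.
  by have [_ _ <-] := IP i u; have [_ _ <-] := IP i v.
exists k => //.
pose F i := dunion (layers (I i)); exists F.
exists (fun x => layers_map (tagged x)); split; last first.
  (* Two vertices of one block with the same image lie in one fibre of [layers_map], which
     1-locality bounds by one element. *)
  move=> i x y xy; have /card_le1_eqP := leq_trans
    (layers_map_card (I i) (layers_map x)) (let: And3 _ c _ := IP i _ in c).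
  by apply; rewrite !inE //; apply/eqP.
split=> //.
- move=> i; exists (d i), (layers (I i)); split; last by exists id => //; exists id.
  by move=> j; apply: layer_cointerval => v; case: (IP i v).
- move=> x y /dunion_adjP[i [a [b [-> -> ab]]]].
  by apply: layers_hom ab => u v /Iadj.
- move=> u v /compl_adjP[uv nuv].
  have /existsNP[i ni] : ~ forall i j, meets (I i u j) (I i v j).
    move=> Iuv; apply: nuv; apply/(SH u v uv).
    have [_ ->] := BP u; have [_ ->] := BP v; apply/box_product_meets => i.
    have [_ _ ->] := IP i u; have [_ _ ->] := IP i v.
    exact/box_meets/Iuv.
  have [|x [y [xy xu yv]]] := layers_edge _ uv ni.
    by move=> w j; case: (IP i w).
  by exists (dinj (x : F i)), (dinj (y : F i)); split=> //; rewrite adj_dinj.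
Qed.

Lemma box_local_leP (R : realType) (H : sgraph) (k : nat) : (0 < k)%N ->
  min_le (box_local R H) k <->
    exists d : nat, exists S : H -> set 'rV[R]_d,
      intersection_graph S /\ forall v, local_box k (S v).
Proof.
move=> k_gt0; rewrite /box_local min_leP; split.
  move=> [s sk [t [F [f [[_ Fint fhom fsurj] finj floc]]]]].
  have [I [Iint In Iadj Inadj]] := cover_intervals Fint fhom finj.
  (* Padding by [k] ensures that the dimension is at least [k]. *)
  exists (t + k), (fun v => box (pad (m := k) (I v))); split; last first.
    move=> v; apply: local_box_pad => //.
    exact: leq_trans (In v) (leq_trans (floc v) sk).
  move=> u v uv; rewrite box_meets pad_meets; split; first exact: Iadj.
  move=> Iuv; apply/negPn/negP => nuv.
  have /fsurj[x [y [xy fx fy]]] : @adj (compl H) u v.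
    by apply/andP; split=> //; exact/eqP.
  by apply: (Inadj x y xy); rewrite fx fy.
move=> [d [S [SH SB]]].
(* Without vertices [d] may be 0, while a cover needs at least one piece; the empty complement then
   serves as the single piece. *)
have [[v0]|H0] := pselect (inhabited H); last first.
  exists k => //; exists 1, (fun _ => compl H), (fun x => tagged x).
  split=> [|i x|v]; last by case: H0; exists.
  - split=> // [i|x|v]; last by case: H0; exists.
    + by exists (fun _ => setT); split=> [v|v]; case: H0; exists.
    + by case: H0; exists; exact: tagged x.
  - by case: H0; exists.
have /choice[I IP] v : exists I : 'I_d -> set R,
  [/\ forall i, real_interval (I i), (nfactors I <= k)%N & S v = box I].
  by case: (SB v) => _.
have Iadj u v : adj u v -> forall i, meets (I u i) (I v i).
  move=> auv; have uv : u <> v by move=> e; move: auv; rewrite e adj_irr.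
  have [_ _ Su] := IP u; have [_ _ Sv] := IP v.
  by apply/box_meets; rewrite -Su -Sv; apply/SH.
have Iint v i : real_interval (I v i) by case: (IP v).
exists k => //; exists d, (layers I), (@layers_map _ _ _ I); split.
- split.
  (* The box of [v0] witnesses [k <= d], hence [d] is positive. *)
  + by apply: leq_trans k_gt0 _; case: (SB v0).
  + by move=> i; apply: layer_cointerval.
  + exact: layers_hom.
  + move=> u v /compl_adjP[uv nuv]; apply: layers_edge => // Iuv.
    apply/nuv/(SH u v uv); have [_ _ ->] := IP u; have [_ _ ->] := IP v.
    exact/box_meets.
- exact: layers_injective.
- by move=> v; apply: leq_trans (layers_map_card I v) _; case: (IP v).
Qed.

Theorem theorem5 (R : realType) (H : sgraph) (k : nat) (k_gt0 : (0 < k)%N) :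
  (min_le (box_union R H) k <->
     exists d : 'I_k -> nat,
       (forall i, (0 < d i)%N) /\
       exists S : H -> set (forall i, 'rV[R]_(d i)),
         intersection_graph S /\
         forall v, exists B : forall i, set 'rV[R]_(d i),
           (forall i, local_box 1 (B i)) /\ S v = box_product B)
  /\
  (min_le (box_local R H) k <->
     exists d : nat, exists S : H -> set 'rV[R]_d,
       intersection_graph S /\ forall v, local_box k (S v)).
Proof. by split; [exact: box_union_leP|exact: box_local_leP]. Qed.
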